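(* Let $m\ge 2$ and consider an $m$-stage LP-QAOA protocol on $N$ qubits with stage depths $p_1,\dots,p_m$, diagonal phase Hamiltonians $C_1,\dots,C_m$, and initial normalized state $|\Phi_0\rangle$. Assume strict hierarchical objectives: the sets $\mathcal G_j=\operatorname{arg\,min}_{z\in\{0,1\}^N}C_j(z)$ satisfy $\mathcal G_m\subseteq\mathcal G_{m-1}\subseteq\cdots\subseteq\mathcal G_1$, and each normalized ideal state $|\Phi_j^\star\rangle$ lies in its target subspace $\mathcal H_j^\star$, $j=0,1,\dots,m$, with $|\Phi_0^\star\rangle=|\Phi_0\rangle$. Let $\theta_j=(\beta_{j,\ell},\gamma_{j,\ell})_{\ell=1}^{p_j}$ be the real parameters returned by the optimizer at stage $j$, and let $|\Phi_j\rangle$ be the actual state after stage $j$ obtained with these parameters. Suppose that for each $j=1,\dots,m$, $$d\big(U_j(R_j^\star;\theta_j)|\Phi_{j-1}^\star\rangle,\;|\Phi_j^\star\rangle\big)\le\varepsilon_j,$$ where for a fixed-mixer stage $U_j(R_j^\star;\theta_j)$ is replaced by the stage circuit $U_j(\theta_j)$ with its fixed mixer. Put $B_j=\sum_{\ell=1}^{p_j}|\beta_{j,\ell}|$ if stage $j$ is an LP-mixer stage and $B_j=0$ if stage $j$ is a fixed-mixer stage, and let $e_j=d(\Phi_j,\Phi_j^\star)$. Then $e_0=0$ and $$e_j\le(1+B_j)\,e_{j-1}+\varepsilon_j\qquad (j=1,\dots,m),$$ and consequently $$e_m\le\sum_{j=1}^{m}\varepsilon_j\prod_{k=j+1}^{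m}(1+B_k).$$
   Context: All states are unit vectors in $(\mathbb C^2)^{\otimes N}$ with computational basis $\{|z\rangle:z\in\{0,1\}^N\}$, and $\|\cdot\|$ is the Euclidean/operator norm. The phase-insensitive distance of normalized states is $d(\psi,\phi)=\min_{\vartheta\in\mathbb R}\||\psi\rangle-e^{i\vartheta}|\phi\rangle\|$. A diagonal Hamiltonian $C_j$ is the Hermitian operator $C_j|z\rangle=C_j(z)|z\rangle$ with $C_j(z)\in\mathbb R$. For a Hermitian operator $R$ and real parameters $\theta_j=(\beta_{j,\ell},\gamma_{j,\ell})_{\ell=1}^{p_j}$, the stage-$j$ circuit with mixer generator $R$ is $$U_j(R;\theta_j)=\prod_{\ell=p_j}^{1}\left[e^{-i\beta_{j,\ell}R}\,e^{-i\gamma_{j,\ell}C_j}\right],$$ products being ordered with larger $\ell$ to the left. LP-QAOA (learned-projector QAOA) protocol: each stage is either a fixed-mixer stage, using a prescribed Hermitian mixer $M_j$ that does not depend on previous states (the first stage is of this type), or an LP-mixer stage ($j\ge2$; in the basic protocol all stages $j\ge 2$ are of this type), using the actual mixer $R_j=\mathbb I-|\Phi_{j-1}\rangle\langle\Phi_{j-1}|$. The actual states are defined recursively by $|\Phi_j\rangle=U_j(R_j;\theta_j)|\Phi_{j-1}\rangle$ at an LP-mixer stage and $|\Phi_j\rangle=U_j(\theta_j)|\Phi_{j-1}\rangle:=U_j(M_j;\theta_j)|\Phi_{j-1}\rangle$ at a fixed-mixer stage. The ideal mixer at an LP-mixer stage is $R_j^\star=\mathbb I-|\Phi_{j-1}^\star\rangle\langle\Phi_{j-1}^\star|$.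 The target subspace $\mathcal H_j^\star$ at stage $j$ is a chosen subspace, usually $\operatorname{span}\{|z\rangle:z\in\mathcal G_j\}$. An empty product equals $1$. *)

(* Defs.v *)
From HB Require Import structures.
From mathcomp Require Import all_boot all_order all_algebra.
From mathcomp Require Import complex.
From mathcomp Require Import all_classical all_reals all_analysis.

Set Implicit Arguments.
Unset Strict Implicit.
Unset Printing Implicit Defensive.

Import Order.TTheory GRing.Theory Num.Theory.
Import numFieldNormedType.Exports.

Local Open Scope ring_scope.
Local Open Scope complex_scope.
Local Open Scope sesquilinear_scope.

Notation bits N := (N.-tuple bool).

(* (C^2)^{\otimes N} in the computational basis: the coordinate of a state
   along |z> is its entry of index enum_rank z. *)
Notation state R N := 'cV[R[i]]_#|{: bits N}|.
Notation operator R N := 'M[R[i]]_#|{: bits N}|.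

Section Hilbert.
Context {R : realType}.

(* The Euclidean norm; MathComp-Analysis' norm on matrices is the sup norm. *)
Definition norm2 n (v : 'cV[R[i]]_n) : R :=
  Num.sqrt (\sum_i Normc.normc (v i 0) ^+ 2).

(* The infimum over the phases is attained, t |-> norm2 (psi - e^{it} phi)
   being continuous and 2 pi-periodic. *)
Definition phase_dist n (psi phi : 'cV[R[i]]_n) : R :=
  inf (range (fun t : R => norm2 (psi - (cos t +i* sin t) *: phi)))%classic.

(* The power series \sum_k A^k / k!, summed in the library's topology on
   matrices over the numFieldType R[i]. *)
Definition expmx n (A : 'M[R[i]]_n) : 'M[R[i]]_n :=
  let K : numFieldType := R[i] in
  limn (series (fun k => (k`!%:R : K)^-1 *: (A : 'M[K]_n) ^+ k)).

Definition expNi n (t : R) (A : 'M[R[i]]_n) : 'M[R[i]]_n :=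
  expmx (- ('i * t%:C) *: A).

Definition projector n (psi : 'cV[R[i]]_n) : 'M[R[i]]_n := psi *m psi ^t*.

End Hilbert.

Section Qubits.
Context {R : realType} {N : nat}.

Definition ket (z : bits N) : state R N := delta_mx (enum_rank z) 0.

Definition diagH (C : bits N -> R) : operator R N :=
  diag_mx (\row_i (C (enum_val i))%:C).

Lemma diagH_ket C z : diagH C *m ket z = (C z)%:C *: ket z.
Proof.
apply/matrixP => i j; rewrite mul_diag_mx !mxE.
by have [->|] := eqVneq i (enum_rank z); rewrite ?enum_rankK //= !mulr0.
Qed.

Definition argmin (C : bits N -> R) : {set bits N} :=
  finset (fun z => [forall y, C z <= C y]).

(* circuit Rm C a p = U(Rm; (beta_l, gamma_l)_{l = 1..p}) for
   a l = (beta_l, gamma_l). *)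
Fixpoint circuit (Rm : operator R N) (C : bits N -> R) (a : nat -> R * R)
    (p : nat) : operator R N :=
  if p is l.+1 then
    (expNi (a l.+1).1 Rm *m expNi (a l.+1).2 (diagH C)) *m circuit Rm C a l
  else 1%:M.

End Qubits.

Inductive stage_mixer (R : realType) (N : nat) :=
  | FixedMixer of operator R N
  | LPMixer.
Arguments LPMixer {R N}.

Definition is_fixed (R : realType) (N : nat) (k : stage_mixer R N) : bool :=
  if k is FixedMixer _ then true else false.

(* Stages are numbered from 1; the values of depth, cost and mixer outside
   1..m play no role in an m-stage protocol. *)
Record protocol (R : realType) (N : nat) := Protocol {
  init : state R N;
  depth : nat -> nat;
  cost : nat -> bits N -> R;
  mixer : nat -> stage_mixer R N }.

Section LPQAOA.
Context {R : realType} {N : nat}.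
Implicit Types (P : protocol R N) (theta : nat -> nat -> R * R).

Definition lp_qaoa P (m : nat) : Prop :=
  [/\ norm2 (init P) = 1,
      is_fixed (mixer P 1) &
      forall (j : nat) (M : operator R N), (1 <= j <= m)%N ->
        mixer P j = FixedMixer M -> M \is hermsymmx].

Definition generator (k : stage_mixer R N) (prev : state R N) : operator R N :=
  match k with
  | FixedMixer M => M
  | LPMixer => 1%:M - projector prev
  end.

(* theta j l = (beta_{j,l}, gamma_{j,l}); prev is the state from which the
   mixer of an LP-mixer stage is built. *)
Definition stage_circuit P theta (j : nat) (prev : state R N) : operator R N :=
  circuit (generator (mixer P j) prev) (cost P j) (theta j) (depth P j).

Fixpoint actual_state P theta (j : nat) : state R N :=
  if j is i.+1 then
    stage_circuit P theta i.+1 (actual_state P theta i)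
      *m actual_state P theta i
  else init P.

Definition mixing_budget P theta (j : nat) : R :=
  if is_fixed (mixer P j) then 0
  else \sum_(1 <= l < (depth P j).+1) `|(theta j l).1|.

End LPQAOA.

(* Main.v *)
Require Import Defs.
From mathcomp Require Import all_boot all_order all_algebra.
From mathcomp Require Import complex.
From mathcomp Require Import all_classical all_reals all_analysis.
From mathcomp Require Import ring.

Import Order.TTheory GRing.Theory Num.Theory.
Import numFieldNormedType.Exports.
Local Open Scope ring_scope.

(** All stage circuits are unitary, so a stage transports the previous error
    without amplification, up to replacing the ideal mixer by the actual one.
    As [1 - P] is a projector, [exp (-i t (1 - P)) = e^{-it} + (1 - e^{-it}) P],
    so replacing one LP mixer by another costs
    [|1 - e^{-i beta}| * ||P_psi - P_phi|| <= |beta| d(psi, phi)] per layer. *)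

(** * Spectral calculus of Hermitian matrices *)

Section Spectral.
Local Open Scope sesquilinear_scope.
Context {C : numClosedFieldType} {n : nat}.
Implicit Types (A P U V : 'M[C]_n) (f g : 'I_n -> C).

Lemma isometry_mul U V :
  U ^t* *m U = 1%:M -> V ^t* *m V = 1%:M -> (U *m V) ^t* *m (U *m V) = 1%:M.
Proof.
move=> UU VV.
by rewrite trmx_mul map_mxM mulmxA -[X in X *m _]mulmxA UU mulmx1.
Qed.

(** The columns of [P ^t*] are the eigenvectors. For unitary [P], pointwise operations on [f] become
    matrix operations, which gives a functional calculus. *)
Definition unitary_diag P f : 'M[C]_n := P ^t* *m diag_mx (\row_i f i) *m P.

Lemma hermitian_unitary_diag A : A \is hermsymmx ->
  exists2 P, P \is unitarymx &
  exists2 f, (forall i, f i \is Num.real) & A = unitary_diag P f.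
Proof.
move=> Aherm; have PU := spectral_unitarymx A.
exists (spectralmx A) => //; exists (spectral_diag A 0).
  by move=> i; have /mxOverP := hermitian_spectral_diag_real Aherm; exact.
have /hermitian_normalmx/orthomx_spectralP := Aherm.
rewrite invmx_unitary// => {1}->; congr (_ *m diag_mx _ *m _).
by apply/rowP => i; rewrite mxE.
Qed.

(** This is the form required by [expNi_decomp]: matrices independent of [f], weighted by the
    eigenvalues. *)
Lemma unitary_diagE P f :
  unitary_diag P f = \sum_i f i *: (P ^t* *m delta_mx i i *m P).
Proof.
rewrite /unitary_diag diag_mx_sum_delta mulmx_sumr mulmx_suml.
by apply: eq_bigr => i _; rewrite mxE -scalemxAr -scalemxAl.
Qed.

Lemma unitary_diag1 P : P \is unitarymx -> unitary_diag P (fun=> 1) = 1%:M.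
Proof.
move=> PU; rewrite /unitary_diag (_ : \row__ _ = const_mx 1).
  by rewrite diag_const_mx mulmx1 -invmx_unitary// mulVmx// unitarymx_unit.
by apply/rowP => i; rewrite !mxE.
Qed.

Lemma unitary_diag_mul P f g : P \is unitarymx ->
  unitary_diag P f *m unitary_diag P g = unitary_diag P (fun i => f i * g i).
Proof.
move=> PU; rewrite /unitary_diag !mulmxA mulmxtVK// -[X in X *m P]mulmxA.
rewrite mulmx_diag; congr (_ *m diag_mx _ *m _).
by apply/rowP => i; rewrite !mxE.
Qed.

Lemma unitary_diag_adj P f :
  (unitary_diag P f) ^t* = unitary_diag P (fun i => (f i)^*).
Proof.
rewrite /unitary_diag !trmx_mul !map_mxM trmxCK tr_diag_mx map_diag_mx mulmxA.
by congr (_ *m diag_mx _ *m _); apply/rowP => i; rewrite !mxE.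
Qed.

Lemma unitary_diag_expr P f k : P \is unitarymx ->
  unitary_diag P f ^+ k = unitary_diag P (fun i => f i ^+ k).
Proof.
move=> PU; elim: k => [|k IH].
  by rewrite expr0 -[RHS]/(unitary_diag P (fun=> 1)) unitary_diag1.
rewrite exprSr IH -[LHS]/(_ *m _) unitary_diag_mul//.
by rewrite /unitary_diag; under eq_mx do rewrite -exprSr.
Qed.

Lemma unitary_diag_isometry P f : P \is unitarymx ->
  (forall i, (f i)^* * f i = 1) ->
  (unitary_diag P f) ^t* *m unitary_diag P f = 1%:M.
Proof.
move=> PU f1; rewrite unitary_diag_adj unitary_diag_mul//.
by rewrite (_ : (fun i => _) = fun=> 1) ?unitary_diag1//; apply/funext.
Qed.

End Spectral.

(** * Inner product, Euclidean norm and rank-one projectors *)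

Section Braket.
Local Open Scope sesquilinear_scope.
Context {R : realType} {n : nat}.
Implicit Types (u v w psi phi : 'cV[R[i]]_n) (z : R[i]).

Definition braket u v : R[i] := (u ^t* *m v) 0 0.

Lemma normcE z : `|z| = (Normc.normc z)%:C%C.
Proof. by []. Qed.

Lemma braketE u v : braket u v = \sum_i (u i 0)^* * v i 0.
Proof. by rewrite /braket !mxE; apply: eq_bigr => i _; rewrite !mxE. Qed.

Lemma braketC u v : braket v u = (braket u v)^*.
Proof.
rewrite !braketE rmorph_sum; apply: eq_bigr => i _.
by rewrite rmorphM /= conjCK mulrC.
Qed.

Lemma braketDr u v w : braket u (v + w) = braket u v + braket u w.
Proof. by rewrite /braket mulmxDr mxE. Qed.

Lemma braketZr u z v : braket u (z *: v) = z * braket u v.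
Proof. by rewrite /braket -scalemxAr mxE. Qed.

Lemma braketBr u v w : braket u (v - w) = braket u v - braket u w.
Proof. by rewrite -scaleN1r braketDr braketZr mulN1r. Qed.

Lemma braketDl u v w : braket (u + v) w = braket u w + braket v w.
Proof. by rewrite braketC braketDr rmorphD /= -!braketC. Qed.

Lemma braketZl z u v : braket (z *: u) v = z^* * braket u v.
Proof. by rewrite braketC braketZr rmorphM /= -braketC. Qed.

Lemma braketBl u v w : braket (u - v) w = braket u w - braket v w.
Proof. by rewrite braketC braketBr rmorphB /= -!braketC. Qed.

Lemma norm2_ge0 v : 0 <= norm2 v.
Proof. exact: sqrtr_ge0. Qed.

Lemma braket_norm2 v : braket v v = (norm2 v ^+ 2)%:C%C.
Proof.
rewrite sqr_sqrtr; last by apply: sumr_ge0 => i _; exact: sqr_ge0.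
rewrite braketE rmorph_sum; apply: eq_bigr => i _ /=.
by rewrite mulrC -normCK normcE rmorphXn.
Qed.

Lemma norm2Z z v : norm2 (z *: v) = Normc.normc z * norm2 v.
Proof.
have z0 : 0 <= Normc.normc z by case: (z) => a b; exact: sqrtr_ge0.
apply/eqP; rewrite -(@eqrXn2 _ 2)// ?norm2_ge0 ?mulr_ge0 ?norm2_ge0//.
apply/eqP/complexI; rewrite -braket_norm2 braketZl braketZr braket_norm2.
by rewrite mulrA [_^* * _]mulrC -normCK normcE -rmorphXn -rmorphM exprMn.
Qed.

Lemma norm20 : norm2 (0 : 'cV[R[i]]_n) = 0.
Proof. by rewrite -(scale0r 0) norm2Z Normc.normc0 mul0r. Qed.

Lemma norm2N v : norm2 (- v) = norm2 v.
Proof. by rewrite -scaleN1r norm2Z normcN Normc.normc1 mul1r. Qed.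

(** Cauchy-Schwarz for [dotmx], which acts on row vectors and conjugates its second argument; hence
    the transposes and the swapped arguments. *)
Lemma norm2_braket_le u v : Normc.normc (braket u v) <= norm2 u * norm2 v.
Proof.
have dotE x y : dotmx y^T x^T = braket x y.
  rewrite dotmxE braketE !mxE; apply: eq_bigr => i _.
  by rewrite !mxE mulrC.
have : `|dotmx v^T u^T| ^+ 2 <= dotmx v^T v^T * dotmx u^T u^T.
  by case: (CauchySchwarz (@dotmx R[i] n) v^T u^T).
rewrite !dotE !braket_norm2 normcE.
rewrite -rmorphXn -rmorphM /= lecR -exprMn mulrC ler_pXn2r// nnegrE.
- by case: braket => a b; exact: sqrtr_ge0.
- by rewrite mulr_ge0 ?norm2_ge0.
Qed.

Lemma norm2D_sqr u v :
  norm2 (u + v) ^+ 2 =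
  norm2 u ^+ 2 + norm2 v ^+ 2 + complex.Re (braket u v) *+ 2.
Proof.
apply: complexI; rewrite -braket_norm2 braketDl !braketDr !braket_norm2.
rewrite (braketC u v) !rmorphD /= -!addrA; congr (_ + _).
rewrite addrCA addrA addrC; congr (_ + _).
case: (braket u v) => a b.
by apply/eqP; rewrite eq_complex /= addNr addr0 !eqxx.
Qed.

Lemma norm2D_ortho u v :
  braket u v = 0 -> norm2 (u + v) ^+ 2 = norm2 u ^+ 2 + norm2 v ^+ 2.
Proof. by move=> uv0; rewrite norm2D_sqr uv0 mul0rn addr0. Qed.

Lemma ler_norm2D u v : norm2 (u + v) <= norm2 u + norm2 v.
Proof.
rewrite -(@ler_pXn2r _ 2)// ?nnegrE ?addr_ge0 ?norm2_ge0//.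
rewrite norm2D_sqr sqrrD addrAC lerD2r lerD2l lerMn2r/=.
apply: le_trans (norm2_braket_le u v).
rewrite -lecR -normcE; apply: le_trans (normc_ge_Re _).
by rewrite lecR ler_norm.
Qed.

Lemma ler_norm2B u v w : norm2 (u - w) <= norm2 (u - v) + norm2 (v - w).
Proof. by rewrite -(subrKA v) ler_norm2D. Qed.

Lemma braket_mul_adj u (A : 'M[R[i]]_n) v :
  braket u (A *m v) = braket (A ^t* *m u) v.
Proof. by rewrite /braket trmx_mul map_mxM trmxCK mulmxA. Qed.

Lemma norm2_isometry (U : 'M[R[i]]_n) v :
  U ^t* *m U = 1%:M -> norm2 (U *m v) = norm2 v.
Proof.
move=> UU; apply/eqP; rewrite -(@eqrXn2 _ 2)// ?norm2_ge0//.
apply/eqP/complexI; rewrite -!braket_norm2.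
by rewrite braket_mul_adj mulmxA UU mul1mx.
Qed.

(** Telescoping: EGU - FGV = EG(U - V) + (E - F)GV, and the isometries E and G leave the norm of the
    first term unchanged. *)
Lemma norm2_productB_le (E F G U V : 'M[R[i]]_n) v :
  E ^t* *m E = 1%:M -> G ^t* *m G = 1%:M ->
  norm2 ((E *m G *m U - F *m G *m V) *m v)
  <= norm2 ((U - V) *m v) + norm2 ((E - F) *m (G *m (V *m v))).
Proof.
move=> EE GG; have -> : (E *m G *m U - F *m G *m V) *m v =
    E *m (G *m ((U - V) *m v)) + (E - F) *m (G *m (V *m v)).
  by rewrite !mulmxBl !mulmxBr !mulmxA addrA subrK.
apply: le_trans (ler_norm2D _ _) _.
by rewrite (norm2_isometry _ _ EE) (norm2_isometry _ _ GG).
Qed.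

Lemma projectorE psi v : projector psi *m v = braket psi v *: psi.
Proof.
apply/matrixP => i j; rewrite /projector -mulmxA mxE big_ord1 [j]ord1 mulrC.
by rewrite [RHS]mxE.
Qed.

Lemma braket_ortho_component psi v : norm2 psi = 1 ->
  braket psi (v - braket psi v *: psi) = 0.
Proof.
by move=> p1; rewrite braketBr braketZr braket_norm2 p1 expr1n mulr1 subrr.
Qed.

(* The norm of P_psi - P_phi is the sine of the angle between the two lines,
   that is the distance of psi to the line of phi. *)
Lemma norm2_projectorB_le psi phi z v : norm2 psi = 1 -> norm2 phi = 1 ->
  norm2 ((projector psi - projector phi) *m v)
  <= norm2 (psi - z *: phi) * norm2 v.
Proof.
move=> psi1 phi1; pose c := braket psi phi; pose b := braket phi v.
(* [s] and [x] are the components of [psi] and [v] orthogonal to [phi], and [y] is that of [phi]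
   orthogonal to [psi]. By Pythagoras [s] and [y] both have squared norm 1 - |c|^2. *)
pose s := psi - c^* *: phi; pose y := phi - c *: psi; pose x := v - b *: phi.
have s_ortho : braket phi s = 0.
  by rewrite /s /c -braketC braket_ortho_component.
have y_ortho : braket psi y = 0 by exact: braket_ortho_component.
have x_ortho : braket phi x = 0 by exact: braket_ortho_component.
have psi_s : 1 = norm2 s ^+ 2 + Normc.normc c ^+ 2.
  rewrite -[1](expr1n _ 2) -{1}psi1 -[psi](subrK (c^* *: phi)) norm2D_ortho.
    congr (_ + _); rewrite norm2Z phi1 mulr1.
    by congr (_ ^+ 2); apply: complexI; rewrite -!normcE norm_conjC.
  by rewrite braketZr braketC -/s s_ortho rmorph0 mulr0.
have phi_y : 1 = norm2 y ^+ 2 + Normc.normc c ^+ 2.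
  rewrite -[1](expr1n _ 2) -{1}phi1 -[phi](subrK (c *: psi)) norm2D_ortho.
    by rewrite norm2Z psi1 mulr1.
  by rewrite braketZr braketC y_ortho rmorph0 mulr0.
have v_x : norm2 v ^+ 2 = norm2 x ^+ 2 + Normc.normc b ^+ 2.
  rewrite -{1}[v](subrK (b *: phi)) norm2D_ortho ?norm2Z ?phi1 ?mulr1//.
  by rewrite braketZr braketC x_ortho rmorph0 mulr0.
(* The orthogonal component [s] is the shortest vector from the line of [phi] to [psi], whatever the
   scalar [z]. *)
have s_le : norm2 s ^+ 2 <= norm2 (psi - z *: phi) ^+ 2.
  have -> : psi - z *: phi = s + (c^* - z) *: phi.
    by rewrite scalerBl addrA subrK.
  rewrite (norm2D_ortho s) ?lerDl ?sqr_ge0//.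
  by rewrite braketZr braketC s_ortho rmorph0 mulr0.
(* Substituting v = x + b phi collects the terms along [psi] and [y], which are orthogonal; <psi, x>
   = <s, x> because [x] is orthogonal to [phi]. *)
have -> : (projector psi - projector phi) *m v = braket s x *: psi - b *: y.
  rewrite mulmxBl !projectorE /s braketBl (braketZl _ phi) x_ortho mulr0 subr0.
  rewrite /x /y braketBr braketZr -/c scalerBr scalerBl scalerA.
  by rewrite opprB addrA subrK.
rewrite -(@ler_pXn2r _ 2)// ?nnegrE ?mulr_ge0 ?norm2_ge0//.
rewrite norm2D_ortho; last first.
  by rewrite -scaleNr braketZl braketZr y_ortho !mulr0.
rewrite norm2N !norm2Z psi1 mulr1 !exprMn.
have -> : norm2 y ^+ 2 = norm2 s ^+ 2.
  by apply: (addIr (Normc.normc c ^+ 2)); rewrite -psi_s -phi_y.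
 apply: le_trans (ler_wpM2r (sqr_ge0 _) s_le).
(* Termwise comparison of |<s,x>|^2 + |b|^2 |s|^2 with |s|^2 (|x|^2 + |b|^2): the second terms
   agree, the first is Cauchy-Schwarz. *)
rewrite v_x mulrDr; apply: lerD; last by rewrite mulrC lexx.
rewrite -exprMn; apply: lerXn2r; last exact: norm2_braket_le.
  by rewrite nnegrE -lecR -normcE normr_ge0.
by rewrite nnegrE mulr_ge0 ?norm2_ge0.
Qed.

End Braket.

(** * Exponential series, scalar phases and exponentials of mixers *)

Section Exponential.
Local Open Scope sesquilinear_scope.
Local Open Scope classical_set_scope.
Context {R : realType}.
Let K : numFieldType := R[i].

(** A positive radius in [R[i]] has zero imaginary part, so the estimate is one in [R]. *)
Lemma cvg_real_complex (f : nat -> R) (l : R) :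
  f k @[k --> \oo] --> l -> ((f k)%:C%C : K) @[k --> \oo] --> (l%:C%C : K).
Proof.
move=> /cvgrPdist_lt fl; apply/cvgrPdist_lt => -[e e'].
rewrite ltcE /= => /andP[/eqP -> e0].
near=> k; rewrite -rmorphB /= normc_def /= expr0n addr0 sqrtr_sqr ltcR.
by near: k; exact: fl.
Unshelve. all: by end_near. Qed.

(** Splitting [k] by parity, (-i)^(2m) = (-1)^m, and exactly one of the two coefficients carries the
    term. *)
Lemma expi_coeff (x : R) (k : nat) :
  (k`!%:R : K)^-1 * (- ('i * x%:C%C)) ^+ k
  = (cos_coeff x k)%:C%C - 'i * (sin_coeff x k)%:C%C.
Proof.
have signE m : (- ('i : K)) ^+ m.*2 = (-1) ^+ m.
  by rewrite -mul2n exprM sqrrN sqrCi.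
have signR m : ((-1) ^+ m : R)%:C%C = (-1) ^+ m by rewrite rmorphXn rmorphN1.
have factE m : ((m`!%:R : R)^-1)%:C%C = (m`!%:R)^-1.
  by rewrite fmorphV rmorph_nat.
rewrite -mulNr exprMn -rmorphXn -(odd_double_half k) -factE.
move: (odd k) k./2 => [] m; rewrite /cos_coeff /sin_coeff /=.
  rewrite add1n /= odd_double !(mul0r, sub0r, mul1r) doubleK.
  rewrite !rmorphM /= signR exprS signE; ring.
rewrite add0n odd_double !(mul0r, mulr0, subr0, mul1r) doubleK.
rewrite -exprnP !rmorphM /= signR signE; ring.
Qed.

Lemma cvg_series_cos_coeff (x : R) :
  series (cos_coeff x) N @[N --> \oo] --> cos x.
Proof. by rewrite unlock; exact: is_cvg_series_cos_coeff. Qed.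

Lemma cvg_series_sin_coeff (x : R) :
  series (sin_coeff x) N @[N --> \oo] --> sin x.
Proof. by rewrite unlock; exact: is_cvg_series_sin_coeff. Qed.


Lemma cvg_series_expi (x : R) :
  series (fun k => (k`!%:R : K)^-1 * (- ('i * x%:C%C)) ^+ k) N @[N --> \oo]
    --> (cos x -i* sin x : K)%C.
Proof.
have -> : (cos x -i* sin x : K)%C = (cos x)%:C%C - 'i * (sin x)%:C%C.
  rewrite -complexiE; apply/eqP; rewrite eq_complex /=.
  by apply/andP; split; apply/eqP; ring.
have -> : series (fun k => (k`!%:R : K)^-1 * (- ('i * x%:C%C)) ^+ k) =
    (fun N => (series (cos_coeff x) N)%:C%C
              - 'i * (series (sin_coeff x) N)%:C%C).
  apply/funext => N; rewrite /series /= !rmorph_sum mulr_sumr -sumrB.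
  by apply: eq_bigr => k _; exact: expi_coeff.
have cosC := cvg_real_complex _ _ (@cvg_series_cos_coeff x).
have sinC := cvg_real_complex _ _ (@cvg_series_sin_coeff x).
exact: cvgB cosC (cvgMl_tmp (a := 'i : K) sinC).
Qed.

(* Sign convention: this is [e^{-ix}]. *)
Definition phase (x : R) : R[i] := (cos x -i* sin x)%C.

(** The matrix series splits into finitely many scalar series, one per eigenvalue. The case k = 0 of
    the hypothesis says that the [E i] sum to the identity. *)
Lemma expNi_decomp (I : finType) n (A : 'M[R[i]]_n) (lam : I -> R)
    (E : I -> 'M[R[i]]_n) (t : R) :
  (forall k, A ^+ k = \sum_i (lam i ^+ k)%:C%C *: E i) ->
  expNi t A = \sum_i phase (t * lam i) *: E i.
Proof.
move=> AE; rewrite /expNi /expmx.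
apply: (@cvg_lim _ (@norm_hausdorff K 'M[K]_n)).
pose s i N : K :=
  series (fun k => (k`!%:R : K)^-1 * (- ('i * (t * lam i)%:C%C)) ^+ k) N.
have -> : series (fun k =>
      (k`!%:R : K)^-1 *: ((- ('i * t%:C%C) *: A : 'M[K]_n) ^+ k))
    = (fun N => \sum_i s i N *: (E i : 'M[K]_n)).
  apply/funext => N; rewrite /s /series /=.
  under [RHS]eq_bigr do rewrite scaler_suml.
  rewrite exchange_big /=; apply: eq_bigr => k _.
  have scaleX (c : R[i]) : (c *: A) ^+ k = c ^+ k *: A ^+ k.
    elim: k => [|k IH]; first by rewrite !expr0 scale1r.
    by rewrite !exprSr IH -[LHS]scalemxAr -[X in _ *: X]scalemxAl scalerA mulrC.
  rewrite [X in _ *: X]scaleX AE !scaler_sumr; apply: eq_bigr => i _.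
  have -> : - ('i * (t * lam i)%:C%C) = - ('i * t%:C%C) * (lam i)%:C%C :> R[i].
    by rewrite rmorphM mulNr mulrA.
  by rewrite rmorphXn exprMn -!scalerA.
apply: cvg_big => [|i _]; first exact: add_continuous.
apply: cvgZr_tmp; exact: cvg_series_expi.
Qed.

Lemma phase0 : phase 0 = 1.
Proof. by rewrite /phase cos0 sin0 oppr0. Qed.

Lemma phaseD (x y : R) : phase (x + y) = phase x * phase y.
Proof.
by rewrite /phase cosD sinD; congr (_ +i* _)%C; rewrite /=; ring.
Qed.

Lemma normc_phase (x : R) : Normc.normc (phase x) = 1.
Proof. by rewrite /= sqrrN cos2Dsin2 sqrtr1. Qed.

Lemma phase_mul_conj (x : R) : (phase x)^* * phase x = 1.
Proof.
by rewrite mulrC -normCK normcE normc_phase expr1n.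
Qed.

(** For x > 0 the mean value theorem gives sin x = x cos c; oddness covers x < 0. *)
Lemma ler_norm_sin (x : R) : `|sin x| <= `|x|.
Proof.
wlog x0 : x / 0 < x.
  move=> pos; have [x0|x0|<-] := ltgtP 0 x; last by rewrite sin0 normr0.
    exact: pos.
  by have := pos (- x); rewrite oppr_gt0 sinN !normrN => /(_ x0).
have cont : {within `[0, x], continuous (@sin R)}.
  by apply: continuous_subspaceT => y; exact: continuous_sin.
have [c _] := @MVT R sin cos 0 x x0 (fun y _ => is_derive_sin y) cont.
rewrite sin0 !subr0 => ->; rewrite normrM ler_piMl//.
by rewrite ler_norml cos_geN1 cos_le1.
Qed.

(** Half-angle formula: |1 - e^{-ix}| = 2 |sin (x/2)|. *)
Lemma norm_1Bphase (x : R) : Normc.normc (1 - phase x) <= `|x|.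
Proof.
set y := x / 2; have xy : x = y + y by rewrite /y; field.
have -> : Normc.normc (1 - phase x) = `|sin y *+ 2|.
  rewrite -sqrtr_sqr /=; congr Num.sqrt; rewrite xy cosD sinD.
  have cos2 : cos y ^+ 2 = 1 - sin y ^+ 2 by rewrite -(cos2Dsin2 y) addrK.
  have -> : (0 - - (sin y * cos y + cos y * sin y)) ^+ 2
      = (sin y ^+ 2 * cos y ^+ 2) *+ 4 by ring.
  by rewrite -!expr2 cos2; ring.
by rewrite xy -mulr2n !normrMn lerMn2r/= ler_norm_sin.
Qed.

(** In an eigenbasis of [A] the exponential is diagonal, with entries of modulus one because the
    eigenvalues are real. *)
Lemma expNi_isometry (t : R) n (A : 'M[R[i]]_n) : A \is hermsymmx ->
  (expNi t A) ^t* *m expNi t A = 1%:M.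
Proof.
move=> /hermitian_unitary_diag[P PU [f f_real AE]].
have fE i : f i = (complex.Re (f i))%:C%C.
  by move: (f_real i); case: (f i) => a b; rewrite complex_real => /eqP ->.
have -> : expNi t A = unitary_diag P (fun i => phase (t * complex.Re (f i))).
  rewrite unitary_diagE; apply: expNi_decomp => k.
  rewrite AE unitary_diag_expr; last exact: PU.
  rewrite unitary_diagE; apply: eq_bigr => i _.
  by rewrite {1}fE rmorphXn.
by apply: unitary_diag_isometry => // i; exact: phase_mul_conj.
Qed.

Lemma complement_projector_hermitian n (psi : 'cV[R[i]]_n) :
  1%:M - projector psi \is hermsymmx.
Proof.
apply/is_hermitianmxP; rewrite expr0 scale1r linearB /= map_mxB.
by rewrite trmx1 map_mx1 /projector trmx_mul map_mxM trmxCK.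
Qed.

Lemma expNi_complement_projector (t : R) n (psi : 'cV[R[i]]_n) :
  norm2 psi = 1 ->
  expNi t (1%:M - projector psi) =
  phase t *: 1%:M + (1 - phase t) *: projector psi.
Proof.
move=> psi1; set P := projector psi.
have PP : P *m P = P.
  rewrite /P {2}/projector mulmxA projectorE braket_norm2 psi1.
  by rewrite expr1n scale1r.
(* The index [true] carries eigenvalue 1 with eigenprojector 1 - P, and [false] carries eigenvalue 0
   with P. *)
rewrite (@expNi_decomp bool _ _ (fun b => b%:R)
  (fun b => if b then 1%:M - P else P)).
  rewrite big_bool /= mulr1 mulr0 phase0 scalerBr scalerBl !scale1r -addrA.
  by congr (_ + _); rewrite addrC.
(* At k = 0 the eigenvalue 0 contributes 0^0 = 1, so the sum is the identity; for larger exponents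
   only the idempotent 1 - P remains. *)
move=> k; rewrite big_bool /= expr1n scale1r; case: k => [|k].
  by rewrite !expr0 scale1r subrK.
rewrite expr0n /= scale0r addr0; elim: k => [|k IH]; first by rewrite expr1.
rewrite exprS IH -[LHS]/(_ *m _) mulmxBl mul1mx mulmxBr mulmx1 PP.
by rewrite subrr subr0.
Qed.

(** The multiples of the identity cancel because they do not depend on the state. *)
Lemma expNi_complement_projectorB (t : R) n (psi phi : 'cV[R[i]]_n) :
  norm2 psi = 1 -> norm2 phi = 1 ->
  expNi t (1%:M - projector psi) - expNi t (1%:M - projector phi) =
  (1 - phase t) *: (projector psi - projector phi).
Proof.
move=> psi1 phi1; rewrite !expNi_complement_projector//.
by rewrite opprD addrACA subrr add0r -scalerBr.
Qed.

End Exponential.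

(** * The phase-insensitive distance *)

Section PhaseDistance.
Local Open Scope sesquilinear_scope.
Context {R : realType} {n : nat}.
Implicit Types (psi phi chi v : 'cV[R[i]]_n).

Lemma phase_dist_le psi phi (t : R) :
  phase_dist psi phi <= norm2 (psi - phase t *: phi).
Proof.
apply: ge_inf; first by exists 0 => _ [s _ <-]; exact: norm2_ge0.
(* [phase t] is e^{-it}, whereas [phase_dist] ranges over e^{it}; hence the opposite parameter. *)
exists (- t); [exact: I | by rewrite /phase cosN sinN].
Qed.

(** With [phase_dist_le], this characterises the infimum; the remaining facts on [phase_dist] are
    derived from these two. *)
Lemma phase_dist_ge psi phi (a : R) :
  (forall t, a <= norm2 (psi - phase t *: phi)) -> a <= phase_dist psi phi.
Proof.
move=> ha; apply: lb_le_inf; first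
  by exists (norm2 (psi - (cos 0 +i* sin 0)%C *: phi)), 0.
by move=> _ [t _ <-]; have := ha (- t); rewrite /phase cosN sinN opprK.
Qed.

Lemma phase_dist_ge0 psi phi : 0 <= phase_dist psi phi.
Proof. by apply: phase_dist_ge => t; exact: norm2_ge0. Qed.

Lemma phase_dist_le_norm2B psi phi : phase_dist psi phi <= norm2 (psi - phi).
Proof. by have := phase_dist_le psi phi 0; rewrite phase0 scale1r. Qed.

Lemma phase_distxx psi : phase_dist psi psi = 0.
Proof.
apply/eqP; rewrite eq_le phase_dist_ge0 andbT.
by rewrite (le_trans (phase_dist_le_norm2B _ _))// subrr norm20.
Qed.

Lemma phase_dist_triangle psi phi chi :
  phase_dist psi chi <= phase_dist psi phi + phase_dist phi chi.
Proof.
(* Each infimum on the right is isolated in turn and replaced by an arbitrary phase; the phases [s]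
   and [t] compose to [s + t]. *)
rewrite -lerBlDl; apply: phase_dist_ge => t; rewrite lerBlDl -lerBlDr.
apply: phase_dist_ge => s; rewrite lerBlDr.
apply: le_trans (phase_dist_le psi chi (s + t)) _.
rewrite phaseD -scalerA; apply: le_trans (ler_norm2B _ (phase s *: phi) _) _.
by rewrite lerD2l -scalerBr norm2Z normc_phase mul1r.
Qed.

Lemma phase_dist_isometry_le (U : 'M[R[i]]_n) psi phi :
  U ^t* *m U = 1%:M -> phase_dist (U *m psi) (U *m phi) <= phase_dist psi phi.
Proof.
move=> UU; apply: phase_dist_ge => t; apply: le_trans (phase_dist_le _ _ t) _.
by rewrite scalemxAr -mulmxBr norm2_isometry.
Qed.

Lemma norm2_projectorB_le_phase_dist psi phi v :
  norm2 psi = 1 -> norm2 phi = 1 -> norm2 v = 1 ->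
  norm2 ((projector psi - projector phi) *m v) <= phase_dist psi phi.
Proof.
move=> psi1 phi1 v1; apply: phase_dist_ge => t.
by have := norm2_projectorB_le psi phi (phase t) v psi1 phi1; rewrite v1 mulr1.
Qed.

End PhaseDistance.

(** * Unitarity of circuits and their sensitivity to the LP mixer *)

Section Circuit.
Local Open Scope sesquilinear_scope.
Context {R : realType} {N : nat}.
Implicit Types (M : operator R N) (C : bits N -> R) (a : nat -> R * R).

Lemma diagH_hermitian C : diagH C \is hermsymmx.
Proof.
apply/is_hermitianmxP; rewrite expr0 scale1r tr_diag_mx map_diag_mx.
congr diag_mx; apply/rowP => i; rewrite !mxE.
by apply/esym/CrealP; rewrite complex_real.
Qed.

Lemma circuit_isometry M C a p : M \is hermsymmx ->
  (circuit M C a p) ^t* *m circuit M C a p = 1%:M.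
Proof.
move=> Mh; elim: p => [|p IH] /=; first by rewrite trmx1 map_mx1 mul1mx.
apply: isometry_mul IH; apply: isometry_mul; apply: expNi_isometry => //.
exact: diagH_hermitian.
Qed.

(** Induction on the depth: both circuits share the phase layers, so each new layer adds only the
    cost of exchanging one mixer, at most |beta| times the distance. *)
Lemma norm2_LP_circuitB_le (psi phi v : state R N) C a p :
  norm2 psi = 1 -> norm2 phi = 1 -> norm2 v = 1 ->
  norm2 ((circuit (1%:M - projector psi) C a p
          - circuit (1%:M - projector phi) C a p) *m v)
  <= (\sum_(1 <= l < p.+1) `|(a l).1|) * phase_dist psi phi.
Proof.
move=> psi1 phi1 v1; elim: p => [|p IH] /=.
  by rewrite subrr mul0mx big_geq// mul0r norm20.
have herm (chi : state R N) := complement_projector_hermitian _ chi.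
have unitG := expNi_isometry (a p.+1).2 _ _ (diagH_hermitian C).
have unitE := expNi_isometry (a p.+1).1 _ _ (herm psi).
apply: le_trans (norm2_productB_le _ _ _ _ _ _ unitE unitG) _.
rewrite big_nat_recr//= mulrDl; apply: lerD; first exact: IH.
rewrite expNi_complement_projectorB// -scalemxAl norm2Z.
apply: ler_pM; [|exact: norm2_ge0|exact: norm_1Bphase|].
  by rewrite -lecR -normcE normr_ge0.
(* The projector difference acts on the image of [v] under the shorter [phi] circuit and one phase
   layer, still a unit vector. *)
apply: norm2_projectorB_le_phase_dist => //.
rewrite (norm2_isometry _ _ unitG) norm2_isometry//.
by apply: circuit_isometry; exact: herm.
Qed.

End Circuit.

(** Discrete Gronwall argument by induction on [m]; the sign of 1 + B lets the previous bound be
    multiplied through. *)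
Lemma error_recursion_bound (R : realDomainType) (e eps B : nat -> R)
    (m : nat) :
  e 0%N = 0 -> (forall j, (1 <= j <= m)%N -> 0 <= B j) ->
  (forall j, (1 <= j <= m)%N -> e j <= (1 + B j) * e j.-1 + eps j) ->
  e m <= \sum_(1 <= j < m.+1) eps j * \prod_(j.+1 <= k < m.+1) (1 + B k).
Proof.
move=> e0; elim: m => [|m IH] B0 rec; first by rewrite big_geq// e0.
have Bm : 0 <= 1 + B m.+1 by rewrite addr_ge0// B0/=.
(* The newest error enters with an empty product. *)
rewrite big_nat_recr//= [X in _ + _ * X]big_geq// mulr1.
apply: le_trans (rec m.+1 _) _; first by rewrite /= leqnn.
rewrite lerD2r /= (le_trans (ler_wpM2l Bm (IH _ _)))//.
- by move=> j /andP[j1 jm]; apply: B0; rewrite j1 leqW.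
- by move=> j /andP[j1 jm]; apply: rec; rewrite j1 leqW.
(* The two sides are equal: every earlier product gains the factor for stage m + 1. *)
rewrite mulr_sumr le_eqVlt; apply/orP; left; apply/eqP.
apply: eq_big_nat => j /andP[_ jm].
by rewrite [in RHS]big_nat_recr//= mulrCA [X in _ * X]mulrC.
Qed.

(** * Error propagation through one stage of the protocol *)

Section Protocol.
Local Open Scope sesquilinear_scope.
Context {R : realType} {N : nat}.
Context (P : protocol R N) (theta : nat -> nat -> R * R).

Lemma mixing_budget_ge0 j : 0 <= mixing_budget P theta j.
Proof. by rewrite /mixing_budget; case: ifP => // _; exact: sumr_ge0. Qed.

Lemma stage_circuit_isometry m j (prev : state R N) :
  lp_qaoa P m -> (1 <= j <= m)%N ->
  (stage_circuit P theta j prev) ^t* *m stage_circuit P theta j prev = 1%:M.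
Proof.
move=> [_ _ fixed_herm] jm; apply: circuit_isometry.
case E : (mixer P j) => [M|] /=; first exact: fixed_herm E.
exact: complement_projector_hermitian.
Qed.

Lemma norm2_actual_state m j : lp_qaoa P m -> (j <= m)%N ->
  norm2 (actual_state P theta j) = 1.
Proof.
move=> hP; elim: j => [|j IH] jm /=; first by case: hP.
rewrite norm2_isometry ?IH ?(ltnW jm)//.
exact: stage_circuit_isometry hP _.
Qed.

(** For a fixed mixer the two circuits coincide, which matches a budget of 0. *)
Lemma norm2_stage_circuitB_le j (psi phi v : state R N) :
  norm2 psi = 1 -> norm2 phi = 1 -> norm2 v = 1 ->
  norm2 ((stage_circuit P theta j psi - stage_circuit P theta j phi) *m v)
  <= mixing_budget P theta j * phase_dist psi phi.
Proof.
move=> psi1 phi1 v1; rewrite /stage_circuit /mixing_budget.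
case: (mixer P j) => [M|] /=; last exact: norm2_LP_circuitB_le.
by rewrite subrr mul0mx mul0r norm20.
Qed.

(** With U the stage circuit, the path U(psi) psi, U(phi) psi-free of phase drift is avoided in
    favour of U(psi) psi, U(psi) phi, U(phi) phi, chi: the first leg is isometric, the second
    exchanges the mixer on a fixed state, the third is the ideal stage error. *)
Lemma stage_error_le m j (psi phi chi : state R N) :
  lp_qaoa P m -> (1 <= j <= m)%N -> norm2 psi = 1 -> norm2 phi = 1 ->
  phase_dist (stage_circuit P theta j psi *m psi) chi <=
  (1 + mixing_budget P theta j) * phase_dist psi phi
  + phase_dist (stage_circuit P theta j phi *m phi) chi.
Proof.
move=> hP jm psi1 phi1; set U := stage_circuit P theta j.
apply: le_trans (phase_dist_triangle _ (U phi *m phi) _) _; rewrite lerD2r.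
apply: le_trans (phase_dist_triangle _ (U psi *m phi) _) _.
rewrite mulrDl mul1r lerD//.
  by apply: phase_dist_isometry_le; exact: stage_circuit_isometry hP jm.
rewrite (le_trans (phase_dist_le_norm2B _ _))// -mulmxBl.
exact: norm2_stage_circuitB_le.
Qed.

End Protocol.

Theorem theoremC1 (R : realType) (N m : nat) (hm : (2 <= m)%N)
    (P : protocol R N) (hP : lp_qaoa P m)
    (hG : forall j : nat, (1 <= j < m)%N ->
      argmin (cost P j.+1) \subset argmin (cost P j))
    (Hstar : nat -> {vspace state R N})
    (Phistar : nat -> state R N)
    (hnorm : forall j : nat, (j <= m)%N -> norm2 (Phistar j) = 1)
    (hH : forall j : nat, (j <= m)%N -> Phistar j \in Hstar j)
    (h0 : Phistar 0%N = init P)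
    (theta : nat -> nat -> R * R)
    (eps : nat -> R)
    (heps : forall j : nat, (1 <= j <= m)%N ->
      phase_dist (stage_circuit P theta j (Phistar j.-1) *m Phistar j.-1)
        (Phistar j) <= eps j) :
  let B := mixing_budget P theta in
  let e := fun j : nat => phase_dist (actual_state P theta j) (Phistar j) in
  [/\ e 0%N = 0,
      forall j : nat, (1 <= j <= m)%N ->
        e j <= (1 + B j) * e j.-1 + eps j &
      e m <= \sum_(1 <= j < m.+1) eps j * \prod_(j.+1 <= k < m.+1) (1 + B k)].
Proof.
move=> B e.
have e0 : e 0%N = 0 by rewrite /e /= h0 phase_distxx.
have rec j : (1 <= j <= m)%N -> e j <= (1 + B j) * e j.-1 + eps j.
  case: j => [//|j] jm; have /andP[_ lt_jm] := jm.
  apply: le_trans (lerD (lexx _) (heps _ jm)).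
  (* Here [psi] is the previous actual state and [phi] the previous ideal one. *)
  apply: (stage_error_le P theta m j.+1 _ _ _ hP jm).
    by apply: (norm2_actual_state P theta m j hP); exact: ltnW.
  by apply: hnorm; exact: ltnW.
split=> //; apply: error_recursion_bound => // j _; exact: mixing_budget_ge0.
Qed.
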